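(* Let $G$ be an infinite group and let $A$ be a subset of $G$. If $A$ is $\nabla$-thin, then $A$ is sparse.
   Context: For a subset $A$ of an infinite group $G$ with identity $e$, $\Delta(A) = \{g \in G : |gA \cap A| = \infty\}$, where $gA = \{ga : a \in A\}$. $\Delta^n$ denotes the $n$-fold iterated application of $\Delta$. A subset $A$ of $G$ is $\nabla$-thin if either $A$ is finite, or there exists $n \in \mathbb{N}$ such that $\Delta^n(A) = \{e\}$. A subset $A$ of $G$ is sparse if for every infinite subset $X$ of $G$ there exists a non-empty finite subset $F$ of $X$ such that $\bigcap_{g \in F} gA$ is finite. *)

(* Defs.v *)
From mathcomp Require Import all_boot.
From mathcomp Require Import boolp classical_sets cardinality.

Set Implicit Arguments.
Unset Strict Implicit.
Unset Printing Implicit Defensive.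

Local Open Scope classical_set_scope.
Local Open Scope group_scope.

(* A [groupType] is an arbitrary, possibly infinite, group. Its carrier is
   required to be a [choiceType], which classically every type is. *)

Definition ltrans (G : groupType) (g : G) (A : set G) : set G :=
  [set g * a | a in A].

Definition Delta (G : groupType) (A : set G) : set G :=
  [set g | infinite_set (ltrans g A `&` A)].

(* The exponent [n] ranges over all of [nat]. Allowing [n = 0] changes nothing:
   [iter 0 (@Delta G) A = [set 1]] means [A = [set 1]], and then [A] is
   finite. *)
Definition nabla_thin (G : groupType) (A : set G) : Prop :=
  finite_set A \/ exists n : nat, iter n (@Delta G) A = [set 1].

Definition sparse (G : groupType) (A : set G) : Prop :=
  forall X : set G, infinite_set X ->
    exists F : set G, [/\ F `<=` X, finite_set F, F !=set0 &
      finite_set (\bigcap_(g in F) ltrans g A)].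

(* Main.v *)
Require Import Defs.
From mathcomp Require Import all_boot.
From mathcomp Require Import boolp classical_sets cardinality.

(** Sparseness descends from [Delta A] to [A].  Suppose an infinite set [X]
    refutes sparseness of [A]: every finite non-empty intersection of translates
    [x A] with [x] in [X] is infinite.  Already for the two-element families
    [{x, y}] this says that [x^-1 * y] lies in [Delta A], that is, [y] lies in
    [x (Delta A)], for all [x], [y] in [X].  Hence [X] itself is contained in
    every intersection of translates of [Delta A] by elements of [X], and the
    same [X] refutes sparseness of [Delta A] ([sparse_Delta]).

    Finite sets are sparse, so if some iterate of [Delta] sends [A] to the
    singleton of the identity, going back one application of [Delta] at a time
    shows that [A] is sparse. *)

Local Open Scope classical_set_scope.
Local Open Scope group_scope.

Lemma finite_ltrans (G : groupType) (g : G) (A : set G) :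
  finite_set A -> finite_set (ltrans g A).
Proof. exact: finite_image. Qed.

Lemma finite_sparse (G : groupType) (A : set G) : finite_set A -> sparse A.
Proof.
move=> finA X /infinite_setN0 [x Xx]; exists [set x]; split.
- by move=> _ ->.
- exact: finite_set1.
- by exists x.
- by rewrite bigcap_set1; apply: finite_ltrans.
Qed.

(** Translating by [x] carries [(x^-1 * y) A `&` A] onto [y A `&` x A], so
    the two sets are finite together. *)
Lemma Delta_mulVg (G : groupType) (A : set G) (x y : G) :
  infinite_set (ltrans x A `&` ltrans y A) -> Delta A (x^-1 * y).
Proof.
apply: contra_not => /(finite_ltrans _ x); apply: sub_finite_set.
move=> _ [[a Aa <-] [b Ab yb_xa]]; exists a; last by [].
by split=> //; exists b => //; rewrite -mulgA yb_xa mulKg.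
Qed.

Lemma sparse_Delta (G : groupType) (A : set G) :
  sparse (Delta A) -> sparse A.
Proof.
move=> spD X infX; apply: contrapT => noF.
have XD x y : X x -> X y -> Delta A (x^-1 * y).
  move=> Xx Xy; apply: Delta_mulVg => finxy; apply: noF.
  exists [set x; y]; split.
  - by move=> _ [] ->.
  - exact: finite_set2.
  - by exists x; left.
  - by rewrite bigcap_setU !bigcap_set1.
have [F [FX _ _ finF]] := spD X infX.
apply: infX; apply: sub_finite_set finF => y Xy x /FX Xx.
by exists (x^-1 * y); [exact: XD | rewrite mulVKg].
Qed.

Lemma sparse_iter_Delta (G : groupType) (n : nat) (A : set G) :
  sparse (iter n (@Delta G) A) -> sparse A.
Proof. by elim: n => [|n IHn] //= /sparse_Delta. Qed.

Local Close Scope group_scope.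

Theorem theorem3 (G : groupType) (hG : infinite_set [set: G]) (A : set G) :
  nabla_thin A -> sparse A.
Proof.
case=> [|[n An1]]; first exact: finite_sparse.
apply: (sparse_iter_Delta _ n); rewrite An1.
exact/finite_sparse/finite_set1.
Qed.
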